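(* Let $t\in\mathbb{C}$ satisfy $t^2+t+1=0$, and let $\mathcal{L}=\{L_0,\dots,L_9\}$ be the set of ten mutually skew lines in $\mathbb{P}^3_{\mathbb{C}}$ in which $L_i$ is spanned by the following two points: $L_0$: $(1,0,-t^2,-t^2)$, $(1,0,-t,-t)$; $L_1$: $(0,1,-t^2,t^2)$, $(0,1,-t,t)$; $L_2$: $(1,0,-t^2,-t)$, $(0,1,-t,t^2)$; $L_3$: $(0,1,-t^2,t)$, $(1,0,-t,-t^2)$; $L_4$: $(0,1,-t,1)$, $(1,0,-1,-t)$; $L_5$: $(1,0,-t,-1)$, $(0,1,-1,t)$; $L_6$: $(1,0,-1,-t^2)$, $(0,1,-t^2,1)$; $L_7$: $(0,1,-1,t^2)$, $(1,0,-t^2,-1)$; $L_8$: $(1,1,t,0)$, $(1,1,t^2,0)$; $L_9$: $(1,-1,0,t)$, $(1,-1,0,t^2)$. Let $\Pi$ be the composition-closure of the set of morphisms of the form $\pi(L,L',L'')$ with $L,L',L''\in\mathcal{L}$ distinct. Then the groupoid $(\mathcal{L},\Pi)$ has automorphism group $\mathrm{Aut}_{(\mathcal{L},\Pi)}\cong S_4$; that is, $\mathrm{Aut}_{(\mathcal{L},\Pi)}(L)\cong S_4$ for every $L\in\mathcal{L}$.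
   Context: Projection maps: for lines $L,L',L''\subseteq\mathbb{P}^3_{\mathbb{C}}$ with $L\cap L'=L'\cap L''=\varnothing$, the isomorphism $\pi(L,L',L''):L\to L''$ sends a point $P\in L$ to the unique point of $L''\cap H$, where $H$ is the unique plane containing $P$ and $L'$. The composition-closure of a set of such maps is the set of all compositions of finite composable sequences of them. The groupoid $(\mathcal{L},\Pi)$ has the lines in $\mathcal{L}$ as objects and the elements of $\Pi$ as morphisms; $\mathrm{Aut}_{(\mathcal{L},\Pi)}(L)$ is the group of all elements of $\Pi$ that are maps $L\to L$. A groupoid is regular if the automorphism groups of all its objects are isomorphic; then $\mathrm{Aut}_{(\mathcal{L},\Pi)}$ denotes their common isomorphism class. *)

(* Defs.v *)
From HB Require Import structures.
From mathcomp Require Import all_boot all_order all_algebra all_fingroup.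
From mathcomp Require Import ring.

Set Implicit Arguments.
Unset Strict Implicit.
Unset Printing Implicit Defensive.
Import GRing.Theory Num.Theory.

Local Open Scope ring_scope.

(* Projective three-space over F is the lattice of linear subspaces of F^4:   *)
(* points, lines and planes are the subspaces of dimension 1, 2 and 3.        *)
Section Projection.
Variable F : numFieldType.
Local Notation V := 'rV[F]_4.

Record line := Line { line_sp :> {vspace V}; line_dim : \dim line_sp == 2 }.
HB.instance Definition _ := [isSub for line_sp].
HB.instance Definition _ := [Choice of line by <:].

Record point_on (L : line) := PointOn {
  point_sp :> {vspace V};
  point_onP : (\dim point_sp == 1) && (point_sp <= L)%VS }.
HB.instance Definition _ L := [isSub for @point_sp L].
HB.instance Definition _ L := [Choice of point_on L by <:].

Definition disjoint_lines (L L' : line) : bool := (L :&: L' == 0)%VS.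

Lemma join_plane (L L' : line) (P : point_on L) :
  disjoint_lines L L' -> \dim (P + L') = 3.
Proof.
case: P => P /= /andP[/eqP dP PL] /eqP LL'.
rewrite dimv_disjoint_sum ?dP ?(eqP (line_dim L')) //.
by apply/eqP; rewrite -subv0 -LL' capvS.
Qed.

Lemma join_plane_uniq (L L' : line) (P : point_on L) (H : {vspace V}) :
  disjoint_lines L L' -> \dim H = 3 -> (P <= H)%VS -> (L' <= H)%VS ->
  H = (P + L')%VS.
Proof.
move=> LL' dH PH L'H; apply/esym/eqP.
by rewrite eqEdim subv_add PH L'H dH join_plane.
Qed.

Lemma proj_subproof (L L' L'' : line) (P : point_on L) :
  disjoint_lines L L' -> disjoint_lines L' L'' ->
  (\dim ((P + L') :&: L'') == 1) && ((P + L') :&: L'' <= L'')%VS.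
Proof.
move=> LL' /eqP L'L''; rewrite capvSr andbT.
have dsum : \dim (P + L' + L'') = 4.
  apply/eqP; rewrite eqn_leq; apply/andP; split.
    by have := dimvS (subvf (P + L' + L'')); rewrite dimvf /dim /= mul1n.
  have <- : \dim (L' + L'') = 4.
    by rewrite dimv_disjoint_sum // !(eqP (line_dim _)).
  by apply: dimvS; rewrite addvS ?addvSr.
have := dimv_sum_cap (P + L') L''.
rewrite dsum join_plane // (eqP (line_dim L'')).
by move/(@addnI 4 _ 1%N)->.
Qed.

(* The projection from L' carries P to the intersection of L'' with the plane *)
(* spanned by P and L'.                                                       *)
Definition proj (L L' L'' : line)
    (hLL' : disjoint_lines L L') (hL'L'' : disjoint_lines L' L'')
    (P : point_on L) : point_on L'' :=
  PointOn (proj_subproof P hLL' hL'L'').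

(* The morphisms of the groupoid on the set of lines cL. Compositions of      *)
(* nonempty sequences suffice to get the identities, since                    *)
(* proj L'' L' L is the inverse of proj L L' L''.                             *)
Inductive groupoid_hom (cL : {pred line}) :
    forall L L'' : line, (point_on L -> point_on L'') -> Prop :=
| hom_proj (L L' L'' : line)
    (hLL' : disjoint_lines L L') (hL'L'' : disjoint_lines L' L'') :
    L \in cL -> L' \in cL -> L'' \in cL ->
    L != L' -> L' != L'' -> L != L'' ->
    groupoid_hom cL (proj hLL' hL'L'')
| hom_comp (L1 L2 L3 : line)
    (f : point_on L1 -> point_on L2) (g : point_on L2 -> point_on L3) :
    groupoid_hom cL f -> groupoid_hom cL g -> groupoid_hom cL (g \o f).

Definition groupoid_Aut (cL : {pred line}) (L : line)
  (f : point_on L -> point_on L) : Prop := groupoid_hom cL f.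

End Projection.
Arguments groupoid_Aut {F} cL L f.

(* A, a set of self-maps of T, is a group under composition with identity id, *)
(* isomorphic to gT through phi.                                              *)
Definition is_group_isomorphic_to (gT : finGroupType) (T : Type)
    (A : (T -> T) -> Prop) : Prop :=
  exists phi : gT -> T -> T,
    [/\ injective phi,
        phi 1%g = id,
        forall x y : gT, phi (x * y)%g = phi x \o phi y
      & forall f : T -> T, A f <-> exists x : gT, f = phi x].

Section Configuration.
Variable F : numFieldType.

Definition vec (a b c d : F) : 'rV[F]_4 := \row_j [:: a; b; c; d]`_j.

Definition spanning_points (t : F) : seq ('rV[F]_4 * 'rV[F]_4) :=
  [:: (vec 1 0 (- t ^+ 2) (- t ^+ 2), vec 1 0 (- t) (- t));
      (vec 0 1 (- t ^+ 2) (t ^+ 2),   vec 0 1 (- t) t);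
      (vec 1 0 (- t ^+ 2) (- t),      vec 0 1 (- t) (t ^+ 2));
      (vec 0 1 (- t ^+ 2) t,          vec 1 0 (- t) (- t ^+ 2));
      (vec 0 1 (- t) 1,               vec 1 0 (- 1) (- t));
      (vec 1 0 (- t) (- 1),           vec 0 1 (- 1) t);
      (vec 1 0 (- 1) (- t ^+ 2),      vec 0 1 (- t ^+ 2) 1);
      (vec 0 1 (- 1) (t ^+ 2),        vec 1 0 (- t ^+ 2) (- 1));
      (vec 1 1 t 0,                   vec 1 1 (t ^+ 2) 0);
      (vec 1 (- 1) 0 t,               vec 1 (- 1) 0 (t ^+ 2))].

Definition span2 (pq : 'rV[F]_4 * 'rV[F]_4) : {vspace 'rV[F]_4} :=
  <<[:: pq.1; pq.2]>>%VS.

Definition L_sp (t : F) (i : 'I_10) : {vspace 'rV[F]_4} :=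
  span2 (nth (0, 0) (spanning_points t) i).

Definition det4 (a b c d e f g h i j k l m n o p : F) : F :=
    (a * f - b * e) * (k * p - l * o) - (a * g - c * e) * (j * p - l * n)
  + (a * h - d * e) * (j * o - k * n) + (b * g - c * f) * (i * p - l * m)
  - (b * h - d * f) * (i * o - k * m) + (c * h - d * g) * (i * n - j * m).

Lemma free_vec4 a b c d e f g h i j k l m n o p :
  det4 a b c d e f g h i j k l m n o p != 0 ->
  free [:: vec a b c d; vec e f g h; vec i j k l; vec m n o p].
Proof.
move=> D0; apply/(@freeP _ _ 4 [tuple _; _; _; _]) => x.
rewrite !big_ord_recl big_ord0 /= addr0.
set x0 := x _; set x1 := x _; set x2 := x _; set x3 := x _ => E.
have Ej r := congr1 (fun M : 'rV[F]_4 => M 0 r) E.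
have {E}e0 := Ej 0; have e1 := Ej (lift ord0 ord0).
have e2 := Ej (lift ord0 (lift ord0 ord0)).
have e3 := Ej (lift ord0 (lift ord0 (lift ord0 ord0))).
move: e0 e1 e2 e3; rewrite !mxE /= => e0 e1 e2 e3.
have cramer (y : F) : det4 a b c d e f g h i j k l m n o p * y = 0 -> y = 0.
  by move/eqP; rewrite mulf_eq0 (negPf D0) /= => /eqP.
pose co a0 a1 a2 b0 b1 b2 c0 c1 c2 : F :=
  a0 * (b1 * c2 - b2 * c1) - a1 * (b0 * c2 - b2 * c0) + a2 * (b0 * c1 - b1 * c0).
have lin (w0 w1 w2 w3 : F) :
    (x0 * a + (x1 * e + (x2 * i + x3 * m))) * w0 +
    (x0 * b + (x1 * f + (x2 * j + x3 * n))) * w1 +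
    (x0 * c + (x1 * g + (x2 * k + x3 * o))) * w2 +
    (x0 * d + (x1 * h + (x2 * l + x3 * p))) * w3 = 0.
  by rewrite e0 e1 e2 e3 !mul0r !addr0.
have y0 : x0 = 0.
  apply: cramer; rewrite -(lin (co f g h j k l n o p) (- co e g h i k l m o p)
    (co e f h i j l m n p) (- co e f g i j k m n o)) /det4 /co; ring.
have y1 : x1 = 0.
  apply: cramer; rewrite -(lin (- co b c d j k l n o p) (co a c d i k l m o p)
    (- co a b d i j l m n p) (co a b c i j k m n o)) /det4 /co; ring.
have y2 : x2 = 0.
  apply: cramer; rewrite -(lin (co b c d f g h n o p) (- co a c d e g h m o p)
    (co a b d e f h m n p) (- co a b c e f g m n o)) /det4 /co; ring.
have y3 : x3 = 0.
  apply: cramer; rewrite -(lin (- co b c d f g h j k l) (co a c d e g h i k l)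
    (- co a b d e f h i j l) (co a b c e f g i j k)) /det4 /co; ring.
move=> r; have -> : r = inord r by rewrite inord_val.
case: r => [[|[|[|[|//]]]] r4] /=.
- by rewrite (_ : inord 0 = ord0) //; apply: val_inj; rewrite /= inordK.
- by rewrite -[RHS]y1; congr x; apply: val_inj; rewrite /= inordK.
- by rewrite -[RHS]y2; congr x; apply: val_inj; rewrite /= inordK.
- by rewrite -[RHS]y3; congr x; apply: val_inj; rewrite /= inordK.
Qed.

Variables (t : F) (ht : t ^+ 2 + t + 1 = 0).

(* Each determinant is an Eisenstein integer of norm 9 or 36; the conjugate   *)
(* of t is - 1 - t.                                                           *)
Lemma free_spanning_points (i j : nat) : (i < j < 10)%N ->
  let P := nth (0, 0) (spanning_points t) in
  free [:: (P i).1; (P i).2; (P j).1; (P j).2].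
Proof.
have nz n (x y : F) : x * y = n.+1%:R -> x != 0.
  by move=> xy; apply: contra_eq_neq xy => ->; rewrite mul0r eq_sym pnatr_eq0.
have t2 : t ^+ 2 = - t - 1.
  by apply/eqP; rewrite -subr_eq0 !opprD !opprK addrA ht.
case: j => [|[|[|[|[|[|[|[|[|[|j]]]]]]]]]] //; last by case/andP.
all: case: i => [|[|[|[|[|[|[|[|[|i]]]]]]]]] // _ /=; apply: free_vec4;
  rewrite ?t2; pattern t;
  match goal with |- (fun x => is_true (@?D x != 0)) _ =>
    first [ apply: (nz 8 (D t) (D (- 1 - t))); rewrite /det4 /=; ring: t2
          | apply: (nz 35 (D t) (D (- 1 - t))); rewrite /det4 /=; ring: t2 ]
  end.
Qed.

Lemma L_sp_dim (i : 'I_10) : \dim (L_sp t i) == 2.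
Proof.
suff : free [:: (nth (0, 0) (spanning_points t) i).1;
                (nth (0, 0) (spanning_points t) i).2] by [].
have [i9 | i9] := ltnP i 9.
  have := @free_spanning_points i 9; rewrite i9 => /(_ isT) /=.
  exact: (@catl_free _ _ [:: _; _] [:: _; _]).
have := @free_spanning_points 0 i; rewrite ltn_ord (leq_trans _ i9) //.
by move=> /(_ isT) /=; apply: (@catr_free _ _ [:: _; _] [:: _; _]).
Qed.

Definition L_line (i : 'I_10) : line F := Line (L_sp_dim i).

Definition config : {pred line F} := [in codom L_line].

Lemma L_line_disjoint (i j : 'I_10) :
  i != j -> disjoint_lines (L_line i) (L_line j).
Proof.
rewrite neq_ltn /disjoint_lines => /orP[] ij; last rewrite capvC.
all: have := @free_spanning_points _ _ (introT andP (conj ij (ltn_ord _))).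
all: rewrite /= [free _](@cat_free _ _ [:: _; _] [:: _; _]) /L_sp /span2.
all: by case/and3P=> _ _ /directv_addP /= ->.
Qed.

Lemma L_line_inj : injective L_line.
Proof.
move=> i j ij; apply/eqP; apply: contraT.
move/L_line_disjoint; rewrite ij /disjoint_lines capvv -dimv_eq0.
by rewrite (eqP (line_dim _)).
Qed.

Lemma config_disjoint (L L' : line F) : L \in config -> L' \in config ->
  L != L' -> disjoint_lines L L'.
Proof.
move=> /codomP[i ->] /codomP[j ->] ij.
by apply: L_line_disjoint; apply: contraNneq ij => ->.
Qed.

End Configuration.

(* Main.v *)
Require Import Defs.
From Stdlib Require Import BinNums FunctionalExtensionality.
From mathcomp Require Import all_boot all_order all_algebra all_fingroup.
From mathcomp Require Import reals complex.
From mathcomp Require Import ring ssrZ.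
Import GRing.Theory.
Local Open Scope ring_scope.
Local Open Scope complex_scope.

(* Fix a basis E_i of L_i (two rows) and two linear forms D_j cutting out L_j *)
(* (two columns). In these coordinates the projection from L_j sends the      *)
(* point x of L_i to the point y of L_k with x E_i D_j = y E_k D_j, so its    *)
(* matrix is E_i D_j (E_k D_j)^-1 up to a scalar. With suitable choices every *)
(* E_i D_j with i <> j is, up to a scalar, a rotation of one fixed cube on    *)
(* the Riemann sphere. These rotations are the permutations of the four       *)
(* diagonals of the cube, so every morphism of the groupoid realizes exactly  *)
(* one element of S_4; the loops L_0 -> L_2 -> L_0 through (L_1, L_4) and     *)
(* through (L_1, L_6) realize two 4-cycles that generate S_4.                 *)

(** By the finite check [line_pairing], every E_i D_j with i <> j is a cube rotation up to a scalar,
    so the matrix E_i D_j (E_k D_j)^-1 of a projection is one too ([proj_perm], [proj_realizes]).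
    Composition preserves this, and every morphism acquires an element of S_4 ([hom_realizes]). The
    element is unique, because only the identity rotation fixes every point of the projective line
    ([realizes_inj]), and it determines the morphism, because every point of L_i has coordinates
    ([realizes_eq]). Thus each automorphism group embeds in S_4. Conversely, explicit loops generate
    S_4 at L_0 ([realized_loops0]), and moving them along morphisms fills the group at every other
    line ([realized_loops]).

    All constants lie in Z[t], so the checks are run on integer pairs and carried to the field by
    [ev]; working up to a scalar avoids division. *)

Set Implicit Arguments.
Unset Strict Implicit.
Unset Printing Implicit Defensive.

(** * Eisenstein integers, rotations of the cube, coordinates of the lines *)

(* The pair (a, b) stands for a + b t. *)
Definition eis : Type := Z * Z.

Definition eadd (x y : eis) : eis := (x.1 + y.1, x.2 + y.2).
Definition esub (x y : eis) : eis := (x.1 - y.1, x.2 - y.2).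
Definition emul (x y : eis) : eis :=
  (x.1 * y.1 - x.2 * y.2, x.1 * y.2 + x.2 * y.1 - x.2 * y.2).
Definition enorm (x : eis) : Z := x.1 * x.1 - x.1 * x.2 + x.2 * x.2.

Definition entry (A : seq (seq eis)) (r c : nat) : eis :=
  nth (0, 0) (nth [::] A r) c.

Fixpoint esum (n : nat) (f : nat -> eis) : eis :=
  if n is n'.+1 then eadd (esum n' f) (f n') else (0, 0).

Definition emulmx (m n p : nat) (A B : seq (seq eis)) : seq (seq eis) :=
  mkseq (fun r => mkseq (fun c =>
    esum n (fun k => emul (entry A r k) (entry B k c))) p) m.

(* Proportionality, tested against the first nonzero entry of the top row of  *)
(* the second matrix.                                                         *)
Definition eprop (A B : seq (seq eis)) : bool :=
  let k := if entry B 0 0 == (0, 0) then 1%N else 0%N in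
  let a := entry A 0 k in
  let b := entry B 0 k in
  [&& enorm a != 0, enorm b != 0 &
      all (fun r => all (fun c =>
        emul b (entry A r c) == emul a (entry B r c)) (iota 0 2)) (iota 0 2)].

(* A permutation s is encoded by the sequence [:: s 0; s 1; s 2; s 3].        *)
Definition codes : seq (seq nat) := permutations (iota 0 4).

Definition code_mul (c d : seq nat) : seq nat := [seq nth 0 d x | x <- c]%N.

(** The sign of the permutation, as the parity of its number of inversions. *)
Fixpoint code_odd (c : seq nat) : bool :=
  if c is x :: c' then odd (count (fun y => y < x)%N c') (+) code_odd c'
  else false.

(* The vertices of a cube on the Riemann sphere: those of the tetrahedron     *)
(* infinity, 1, t, t^2 and their antipodes 0, -2, -2t, -2t^2.                 *)
Definition vertex (antipode : bool) (a : nat) : eis * eis :=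
  if antipode then
    nth ((0, 0), (0, 0))
      [:: ((0, 0), (1, 0)); ((-2, 0), (1, 0)); ((0, -2), (1, 0));
          ((2, 2), (1, 0))] a
  else
    nth ((0, 0), (0, 0))
      [:: ((1, 0), (0, 0)); ((1, 0), (1, 0)); ((0, 1), (1, 0));
          ((-1, -1), (1, 0))] a.

Definition ebracket (v w : eis * eis) : eis :=
  esub (emul v.1 w.2) (emul v.2 w.1).

(* The rotation of the cube that sends the vertex c(a) to the vertex a or to  *)
(* its antipode, according to the parity of c, for each of the four diagonals *)
(* a; it acts on row vectors and is interpolated from its values at three     *)
(* vertices.                                                                  *)
Definition rotation (c : seq nat) : seq (seq eis) :=
  let p a := vertex false (nth 0%N c a) in
  let q := vertex (code_odd c) in
  let al := emul (ebracket (p 2%N) (p 0%N)) (ebracket (q 1%N) (q 2%N)) in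
  let be := emul (ebracket (p 2%N) (p 1%N)) (ebracket (q 0%N) (q 2%N)) in
  let row v :=
    let x := emul al (ebracket v (p 1%N)) in
    let y := emul be (ebracket v (p 0%N)) in
    [:: esub (emul x (q 0%N).1) (emul y (q 1%N).1);
        esub (emul x (q 0%N).2) (emul y (q 1%N).2)] in
  [:: row ((1, 0), (0, 0)); row ((0, 0), (1, 0))].

(* line_basis and line_forms are normalised so that all E_i D_j with i <> j   *)
(* are multiples of rotations of the cube.                                    *)
Definition line_basis : seq (seq (seq eis)) :=
  [:: [:: [:: (1, 1); (0, 0); (0, 0); (0, 0)]; [:: (0, 0); (0, 0); (1, 0); (1, 0)]];
      [:: [:: (0, 0); (1, 0); (0, 0); (0, 0)]; [:: (0, 0); (0, 0); (-1, 0); (1, 0)]];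
      [:: [:: (1, 1); (1, 0); (0, 0); (0, -1)]; [:: (1, 0); (-1, 0); (1, 2); (1, 0)]];
      [:: [:: (1, 1); (-1, 0); (0, -1); (0, 0)]; [:: (1, 0); (1, 0); (1, 0); (1, 2)]];
      [:: [:: (-1, 0); (0, 0); (1, 0); (0, 1)]; [:: (1, 0); (1, 2); (1, 1); (1, 1)]];
      [:: [:: (1, 1); (1, 0); (0, 0); (-1, 0)]; [:: (0, 1); (0, -1); (1, 2); (1, 0)]];
      [:: [:: (0, 1); (1, 0); (1, 0); (0, 0)]; [:: (1, 1); (1, 1); (-1, 0); (1, 2)]];
      [:: [:: (1, 0); (0, 0); (1, 1); (-1, 0)]; [:: (1, 1); (-1, 1); (1, 0); (1, 0)]];
      [:: [:: (0, 0); (0, 0); (1, 0); (0, 0)]; [:: (1, 0); (1, 0); (0, 0); (0, 0)]];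
      [:: [:: (0, 0); (0, 0); (0, 0); (1, 0)]; [:: (1, 0); (-1, 0); (0, 0); (0, 0)]]].

Definition line_forms : seq (seq (seq eis)) :=
  [:: [:: [:: (0, 0); (0, 0)]; [:: (0, 0); (1, 0)]; [:: (1, 0); (0, 0)]; [:: (-1, 0); (0, 0)]];
      [:: [:: (0, 0); (1, 0)]; [:: (0, 0); (0, 0)]; [:: (1, 0); (0, 0)]; [:: (1, 0); (0, 0)]];
      [:: [:: (-1, 0); (1, 1)]; [:: (1, 2); (0, 0)]; [:: (1, 0); (0, 1)]; [:: (1, 0); (1, 0)]];
      [:: [:: (1, 0); (0, 1)]; [:: (1, 0); (-1, -1)]; [:: (1, 0); (1, 0)]; [:: (1, 2); (0, 0)]];
      [:: [:: (1, 0); (1, 0)]; [:: (1, 0); (0, 1)]; [:: (0, 1); (1, 0)]; [:: (-2, -1); (0, 0)]];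
      [:: [:: (1, 0); (0, 1)]; [:: (1, 0); (1, 0)]; [:: (0, 1); (1, 0)]; [:: (2, 1); (0, 0)]];
      [:: [:: (0, 1); (1, 0)]; [:: (0, -1); (0, -1)]; [:: (1, 2); (0, 0)]; [:: (1, 0); (0, 1)]];
      [:: [:: (0, 1); (1, 0)]; [:: (0, 1); (0, 1)]; [:: (1, 0); (0, 1)]; [:: (1, 2); (0, 0)]];
      [:: [:: (-1, 0); (0, 0)]; [:: (1, 0); (0, 0)]; [:: (0, 0); (0, 0)]; [:: (0, 0); (1, 0)]];
      [:: [:: (1, 0); (0, 0)]; [:: (1, 0); (0, 0)]; [:: (0, 0); (1, 1)]; [:: (0, 0); (0, 0)]]].

(** * Finite computations with the rotations and the lines *)

(** The order is reversed because [rotation c] carries diagonal c(a) to a, and row vectors meet the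
    left factor first. *)
Lemma rotation_mul c d : c \in codes -> d \in codes ->
  eprop (emulmx 2 2 2 (rotation d) (rotation c)) (rotation (code_mul c d)).
Proof.
have /allP ck : all (fun c => all (fun d => eprop
   (emulmx 2 2 2 (rotation d) (rotation c)) (rotation (code_mul c d))) codes)
   codes by vm_compute.
by move=> cC dC; have /allP/(_ d dC) := ck c cC.
Qed.

Lemma rotation_not_scalar (c : seq nat) (M := entry (rotation c)) :
    c \in codes -> c != iota 0 4 ->
  [|| enorm (esub (M 0 0) (M 1 1)) != 0, enorm (M 0 1) != 0
    | enorm (M 1 0) != 0].
Proof.
have /allP ck : all (fun c => let M := entry (rotation c) in
    (c != iota 0 4) ==> [|| enorm (esub (M 0 0) (M 1 1)) != 0,
      enorm (M 0 1) != 0 | enorm (M 1 0) != 0]) codes by vm_compute.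
by rewrite {}/M => /ck; case: (c == _).
Qed.

Lemma line_pairing i j : (i < 10)%N -> (j < 10)%N -> i != j ->
  exists2 c, c \in codes &
    eprop (emulmx 2 4 2 (nth [::] line_basis i) (nth [::] line_forms j))
      (rotation c).
Proof.
have /allP ck : all (fun i => all (fun j => (i != j) ==> has (fun c =>
  eprop (emulmx 2 4 2 (nth [::] line_basis i) (nth [::] line_forms j))
    (rotation c)) codes) (iota 0 10)) (iota 0 10) by vm_compute.
move=> i10 j10 ij.
have iI : i \in iota 0 10 by rewrite mem_iota.
have jI : j \in iota 0 10 by rewrite mem_iota.
have /allP/(_ j jI) := ck i iI.
by rewrite ij => /hasP[c]; exists c.
Qed.

Lemma line_pairing_self i : (i < 10)%N ->
  emulmx 2 4 2 (nth [::] line_basis i) (nth [::] line_forms i) =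
  nseq 2 (nseq 2 (0, 0)).
Proof.
have /allP ck : all (fun i => emulmx 2 4 2 (nth [::] line_basis i)
  (nth [::] line_forms i) == nseq 2 (nseq 2 (0, 0))) (iota 0 10)
  by vm_compute.
by move=> i10; apply/eqP/ck; rewrite mem_iota.
Qed.

Lemma rotation_id : eprop (rotation (iota 0 4))
  [:: [:: (1, 0); (0, 0)]; [:: (0, 0); (1, 0)]].
Proof. by vm_compute. Qed.

(* The two 4-cycles are the permutations realized by the loops at L_0.        *)
Lemma codes_generated (S : seq nat -> Prop) :
    (forall c d, S c -> S d -> S (code_mul c d)) ->
    S [:: 3; 2; 0; 1] -> S [:: 2; 0; 3; 1] ->
  forall c, c \in codes -> S c.
Proof.
move=> SM Sc Sd.
pose step l := undup (l ++ allpairs code_mul l l).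
pose gens : seq (seq nat) := [:: [:: 3; 2; 0; 1]; [:: 2; 0; 3; 1]].
have step_closed l : (forall c, c \in l -> S c) -> forall c, c \in step l -> S c.
  move=> Sl c; rewrite mem_undup mem_cat => /orP[/Sl //|].
  by move=> /allpairsP[[u v] /= [/Sl Su /Sl Sv ->]]; exact: SM.
(* Three rounds give all products of at most 8 generators, enough for the 24 codes. *)
have /allP ck : all (mem (iter 3 step gens)) codes by vm_compute.
move=> c /ck; move: c; do 3!apply: (step_closed).
by move=> c; rewrite !inE => /orP[] /eqP ->.
Qed.

(** * Permutations and their codes *)

Definition code (s : {perm 'I_4}) : seq nat := [seq val (s i) | i <- enum 'I_4].

Lemma code_in_codes s : code s \in codes.
Proof.
rewrite mem_permutations -(val_enum_ord 4) /code (map_comp val s).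
apply: perm_map.
apply: uniq_perm; [|exact: enum_uniq|].
  by rewrite (map_inj_uniq (@perm_inj _ s)) enum_uniq.
move=> i; rewrite mem_enum; apply/mapP; exists ((s^-1)%g i).
  by rewrite mem_enum.
by rewrite permKV.
Qed.

Lemma nth_code s (i : 'I_4) : nth 0%N (code s) i = s i.
Proof. by rewrite (nth_map i) ?size_enum_ord // nth_ord_enum. Qed.

Lemma codeM s s' : code (s * s')%g = code_mul (code s) (code s').
Proof.
rewrite /code_mul /code -[RHS]map_comp; apply: eq_map => i /=.
by rewrite permM -[in LHS]nth_code.
Qed.

Lemma code1 : code 1%g = iota 0 4.
Proof. by rewrite -(val_enum_ord 4); apply: eq_map => i; rewrite perm1. Qed.

Lemma code_inj : injective code.
Proof.
by move=> s s' eq; apply/permP => i; apply: val_inj; rewrite /= -!nth_code eq.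
Qed.

Lemma code_onto c : c \in codes -> exists s, code s = c.
Proof.
rewrite mem_permutations => cP.
have sz : size c = 4 by rewrite (perm_size cP) size_iota.
have lt4 (i : 'I_4) : (nth 0 c i < 4)%N.
  have : nth 0%N c i \in c by rewrite mem_nth ?sz.
  by rewrite (perm_mem cP) mem_iota.
have inj : injective (fun i : 'I_4 => Ordinal (lt4 i)).
  move=> i j /(congr1 val) /= /eqP; rewrite nth_uniq ?sz //.
    by move/eqP/val_inj.
  by rewrite (perm_uniq cP) iota_uniq.
exists (perm inj); apply: (@eq_from_nth _ 0%N).
  by rewrite size_map size_enum_ord sz.
move=> i; rewrite size_map size_enum_ord => i4.
by rewrite (nth_code _ (Ordinal i4)) permE.
Qed.

(** * Matrices up to a nonzero scalar *)

Definition mxsim (F : fieldType) m n (A B : 'M[F]_(m, n)) : Prop :=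
  exists2 a, a != 0 & A = a *: B.

Section MxSim.
Variable F : fieldType.

Lemma mxsim_sym m n (A B : 'M[F]_(m, n)) : mxsim A B -> mxsim B A.
Proof.
by case=> a a0 ->; exists a^-1; rewrite ?invr_eq0 // scalerA mulVf // scale1r.
Qed.

Lemma mxsim_trans m n (B A C : 'M[F]_(m, n)) :
  mxsim A B -> mxsim B C -> mxsim A C.
Proof.
by case=> a a0 -> [b b0 ->]; exists (a * b); rewrite ?mulf_neq0 // scalerA.
Qed.

Lemma mxsimM m n p (A A' : 'M[F]_(m, n)) (B B' : 'M[F]_(n, p)) :
  mxsim A A' -> mxsim B B' -> mxsim (A *m B) (A' *m B').
Proof.
case=> a a0 -> [b b0 ->]; exists (a * b); rewrite ?mulf_neq0 //.
by rewrite -scalemxAl -scalemxAr scalerA.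
Qed.

Lemma mxsim_refl m n (A : 'M[F]_(m, n)) : mxsim A A.
Proof. by exists 1; rewrite ?oner_neq0 ?scale1r. Qed.

Lemma mxsim_vline n (u v : 'rV[F]_n) : mxsim u v -> <[u]>%VS = <[v]>%VS.
Proof.
case=> a a0 ->; apply/eqP; rewrite eqEsubv -!memvE memvZ ?memv_line //=.
by rewrite -[v in v \in _](scalerK a0) memvZ ?memv_line.
Qed.

Lemma vline_mxsim n (u v : 'rV[F]_n) : u != 0 -> <[u]>%VS = <[v]>%VS -> mxsim u v.
Proof.
move=> u0 uv; have /vlineP[a ua] : u \in <[v]>%VS by rewrite -uv memv_line.
by exists a => //; apply: contraNneq u0 => a0; rewrite ua a0 scale0r.
Qed.

Lemma mxsim_unit n (A B : 'M[F]_n) : mxsim A B -> B \in unitmx -> A \in unitmx.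
Proof. by case=> a a0 -> Bu; rewrite unitmxZ ?unitfE. Qed.

(** The basis vectors force the off-diagonal entries to vanish; their sum then forces equal diagonal
    entries. *)
Lemma eigen_scalar (A : 'M[F]_2) :
  (forall x : 'rV_2, x != 0 -> mxsim (x *m A) x) ->
  [/\ A 0 0 = A 1 1, A 0 1 = 0 & A 1 0 = 0].
Proof.
move=> H.
have off i j : i != j -> A i j = 0.
  move=> ij; have [|a _] := H (delta_mx 0 i).
    by apply/eqP => /rowP/(_ i)/eqP; rewrite !mxE !eqxx oner_eq0.
  rewrite -rowE => /rowP/(_ j); rewrite !mxE eqxx (eq_sym j) (negPf ij) /=.
  by rewrite mulr0.
split; [|exact: off|exact: off].
have [|a _ /rowP E] := H (const_mx 1).
  by apply/eqP => /rowP/(_ 0)/eqP; rewrite !mxE oner_eq0.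
have := E 0; have := E 1; rewrite !mxE !big_ord_recl !big_ord0 !mxE /=.
rewrite (_ : lift ord0 ord0 = 1); last exact: val_inj.
by rewrite (off 0 1) // (off 1 0) // !mul1r !mulr1 !addr0 add0r => -> ->.
Qed.
End MxSim.

(** * Evaluation at t and the projective representation of S_4 *)

Section Configuration.
Variables (F : numFieldType) (t : F) (ht : t ^+ 2 + t + 1 = 0).

Let t2 : t ^+ 2 = - t - 1.
Proof. by apply/eqP; rewrite -subr_eq0 !opprD !opprK addrA ht. Qed.

Definition ev (x : eis) : F := (int_of_Z x.1)%:~R + (int_of_Z x.2)%:~R * t.

Lemma evD x y : ev (eadd x y) = ev x + ev y.
Proof. by rewrite /ev /= !rmorphD /=; ring. Qed.

Lemma evB x y : ev (esub x y) = ev x - ev y.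
Proof. by rewrite /ev /= !rmorphB /=; ring. Qed.

Lemma evM x y : ev (emul x y) = ev x * ev y.
Proof. by rewrite /ev /= !(rmorphD, rmorphB, rmorphM) /=; ring: t2. Qed.

Lemma ev0 : ev (0, 0) = 0.
Proof. by rewrite /ev /= mul0r addr0. Qed.

Lemma ev_neq0 x : enorm x != 0 -> ev x != 0.
Proof.
(* The second factor is the conjugate a + b t^2 = (a - b) - b t. *)
move=> nx; have : ev x * ev (x.1 - x.2, - x.2) != 0.
  rewrite (_ : _ * _ = (int_of_Z (enorm x))%:~R).
    by rewrite intr_eq0 -(rmorph0 int_of_Z) (inj_eq (can_inj int_of_ZK)).
  by rewrite /ev /enorm /= !(rmorphD, rmorphB, rmorphM, rmorphN) /=; ring: t2.
by rewrite mulf_eq0 negb_or => /andP[].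
Qed.

Definition evmx m n (A : seq (seq eis)) : 'M[F]_(m, n) :=
  \matrix_(r, c) ev (entry A r c).

Lemma evmxM m n p A B :
  evmx m p (emulmx m n p A B) = evmx m n A *m evmx n p B.
Proof.
apply/matrixP => r c; rewrite !mxE /entry !nth_mkseq //.
under eq_bigr do rewrite !mxE.
rewrite -(big_mkord xpredT (fun k => ev (entry A r k) * ev (entry B k c))).
elim: n => [|n IHn] /=; first by rewrite big_geq // ev0.
by rewrite big_nat_recr //= evD evM IHn.
Qed.

Lemma eprop_mxsim A B : eprop A B -> mxsim (evmx 2 2 A) (evmx 2 2 B).
Proof.
rewrite /eprop; set a := entry A _ _; set b := entry B _ _.
case/and3P=> /ev_neq0 a0 /ev_neq0 b0 /allP H.
exists (ev a / ev b); first by rewrite mulf_neq0 ?invr_eq0.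
apply/matrixP => r c; rewrite !mxE.
have rI : (r : nat) \in iota 0 2 by rewrite mem_iota ltn_ord.
have cI : (c : nat) \in iota 0 2 by rewrite mem_iota ltn_ord.
have /allP/(_ _ cI)/eqP/(congr1 ev) := H _ rI; rewrite !evM => eq.
by apply: (mulfI b0); rewrite eq mulrA mulrCA divff // mulr1.
Qed.

Definition rho (s : {perm 'I_4}) : 'M[F]_2 := evmx 2 2 (rotation (code s)).

Lemma rhoM s s' : mxsim (rho s *m rho s') (rho (s' * s)%g).
Proof.
rewrite /rho -evmxM codeM.
by apply/eprop_mxsim/rotation_mul; exact: code_in_codes.
Qed.

Lemma rho1 : mxsim (rho 1%g) 1%:M.
Proof.
rewrite (_ : 1%:M = evmx 2 2 [:: [:: (1, 0); (0, 0)]; [:: (0, 0); (1, 0)]]).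
  by rewrite /rho code1; exact/eprop_mxsim/rotation_id.
apply/matrixP => r c; rewrite !mxE.
by case: r c => [[|[|//]] ?] [[|[|//]] ?]; rewrite /entry /ev /= mul0r addr0.
Qed.

Lemma rho_unit s : rho s \in unitmx.
Proof.
have : rho s *m rho s^-1%g \in unitmx.
  apply: (mxsim_unit (rhoM _ _)); rewrite mulVg.
  by apply: (mxsim_unit rho1); rewrite unitmx1.
by rewrite unitmx_mul => /andP[].
Qed.

Lemma rho_faithful s :
  (forall x : 'rV_2, x != 0 -> mxsim (x *m rho s) x) -> s = 1%g.
Proof.
move=> /eigen_scalar[E00 E01 E10]; apply: code_inj; rewrite code1.
apply/eqP/negPn/negP => /(rotation_not_scalar (code_in_codes s)).
move: E00 E01 E10; rewrite !mxE => E00 E01 E10.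
case/or3P=> /ev_neq0/negP; apply; apply/eqP => //.
by rewrite evB E00 subrr.
Qed.

Lemma rho_inj s s' :
  (forall x : 'rV_2, x != 0 -> mxsim (x *m rho s) (x *m rho s')) -> s = s'.
Proof.
move=> H; apply/eqP; rewrite -(inj_eq (mulgI s'^-1%g)) mulVg; apply/eqP.
apply: rho_faithful => x x0.
apply: mxsim_trans (mxsimM (mxsim_refl x) (mxsim_sym (rhoM _ _))) _.
rewrite mulmxA; apply: mxsim_trans (mxsimM (H x x0) (mxsim_refl _)) _.
rewrite -mulmxA -[X in mxsim _ X]mulmx1; apply: mxsimM (mxsim_refl x) _.
by apply: mxsim_trans rho1; rewrite -(mulVg s'); exact: rhoM.
Qed.

(** * Coordinates on the ten lines *)

Definition basis (i : nat) : 'M[F]_(2, 4) := evmx 2 4 (nth [::] line_basis i).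
Definition forms (j : nat) : 'M[F]_(4, 2) := evmx 4 2 (nth [::] line_forms j).

Lemma basis_forms (i j : 'I_10) : i != j ->
  exists s, mxsim (basis i *m forms j) (rho s).
Proof.
move=> ij; have [c cC /eprop_mxsim] := line_pairing (ltn_ord i) (ltn_ord j) ij.
by have [s <-] := code_onto cC; rewrite evmxM; exists s.
Qed.

Lemma basis_forms_self (i : 'I_10) : basis i *m forms i = 0.
Proof.
rewrite -evmxM line_pairing_self //; apply/matrixP => r c; rewrite !mxE.
by case: r c => [[|[|//]] ?] [[|[|//]] ?]; exact: ev0.
Qed.

Lemma spanning_forms (i : 'I_10) (v := nth (0, 0) (spanning_points t) i) :
  v.1 *m forms i = 0 /\ v.2 *m forms i = 0.
Proof.
rewrite {}/v; case: i => [[|[|[|[|[|[|[|[|[|[|//]]]]]]]]]] ?] /=.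
all: split; apply/rowP => -[[|[|//]] ?].
all: rewrite !mxE !big_ord_recl big_ord0 !mxE /entry /ev /=.
all: rewrite /BinPos.Pos.to_nat /=; ring: t2.
Qed.

Lemma pairing_unit (i j : 'I_10) : i != j -> basis i *m forms j \in unitmx.
Proof.
by move=> /basis_forms[s] /mxsim_unit; apply; exact: rho_unit.
Qed.

Lemma other_line (i : 'I_10) : exists j : 'I_10, j != i.
Proof.
exists (if i == ord0 then ord_max else ord0).
by case: ifP => [/eqP -> //|/negbT]; rewrite eq_sym.
Qed.

(** D_i kills both spanning points of L_i, and it has rank 2 because E_j D_i is invertible for any
    other j; the dimensions then agree. *)
Lemma mem_L_sp (i : 'I_10) v : (v \in L_sp t i) = (v *m forms i == 0).
Proof.
pose f : 'Hom('rV[F]_4, 'rV[F]_2) := linfun (mulmxr (forms i)).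
have fE u : f u = u *m forms i by rewrite lfunE.
suff -> : L_sp t i = lker f by rewrite memv_ker fE.
apply/eqP; rewrite eqEdim (eqP (L_sp_dim ht i)); apply/andP; split.
  apply/span_subvP => u; rewrite !inE => /orP[] /eqP ->; rewrite memv_ker fE.
    by have [-> _] := spanning_forms i.
  by have [_ ->] := spanning_forms i.
have [j ji] := other_line i.
have full : limg f = fullv.
  apply/eqP; rewrite eqEsubv subvf; apply/subvP => y _.
  apply/memv_imgP; exists (y *m invmx (basis j *m forms i) *m basis j).
    exact: memvf.
  by rewrite fE -[RHS]mulmxA mulmxKV ?pairing_unit.
have := limg_ker_dim f fullv.
rewrite full capfv !dimvf /dim /= !mul1n => /eqP.
by rewrite (eqn_add2r 2 _ 2) => /eqP ->.
Qed.

Lemma basis_mem (i : 'I_10) x : x *m basis i \in L_sp t i.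
Proof. by rewrite mem_L_sp -mulmxA basis_forms_self mulmx0. Qed.

Lemma basis_inj (i : 'I_10) : injective (fun x : 'rV[F]_2 => x *m basis i).
Proof.
have [j ji] := other_line i; move=> x y /(congr1 (mulmx^~ (forms j))).
rewrite -!mulmxA; apply: (can_inj (mulmxK _)).
by rewrite pairing_unit // eq_sym.
Qed.

Lemma basis_onto (i : 'I_10) v : v \in L_sp t i -> exists x, v = x *m basis i.
Proof.
pose f : 'Hom('rV[F]_2, 'rV[F]_4) := linfun (mulmxr (basis i)).
have fE u : f u = u *m basis i by rewrite lfunE.
suff -> : L_sp t i = limg f by case/memv_imgP => x _; rewrite fE; exists x.
apply/esym/eqP; rewrite eqEdim (eqP (L_sp_dim ht i)); apply/andP; split.
  by apply/subvP => _ /memv_imgP[x _ ->]; rewrite fE basis_mem.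
rewrite limg_dim_eq ?dimvf //.
by apply/eqP; rewrite capfv; apply/lker0P => x y; rewrite !fE; exact: basis_inj.
Qed.

Lemma point_coord (i : 'I_10) (P : point_on (L_line ht i)) :
  exists2 x, x != 0 & P = <[x *m basis i]>%VS :> {vspace 'rV[F]_4}.
Proof.
have /andP[/eqP dimP PL] := point_onP P.
have v0 : vpick P != 0 by rewrite vpick0 -dimv_eq0 dimP.
have [x vx] := basis_onto (subvP PL _ (memv_pick P)).
exists x; first by apply: contraNneq v0 => x0; rewrite vx x0 mul0mx.
by apply/esym/eqP; rewrite -vx eqEdim -memvE memv_pick dim_vline v0 dimP.
Qed.

Lemma basis_neq0 (i : 'I_10) (x : 'rV_2) : x != 0 -> x *m basis i != 0.
Proof. by apply: contra_neq => x0; apply: (@basis_inj i); rewrite mul0mx. Qed.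

Lemma rho_neq0 s (x : 'rV_2) : x != 0 -> x *m rho s != 0.
Proof.
apply: contra_neq => /(congr1 (mulmx^~ (invmx (rho s)))).
by rewrite mul0mx mulmxK ?rho_unit.
Qed.

Lemma coord_point (i : 'I_10) (x : 'rV_2) : x != 0 ->
  exists P : point_on (L_line ht i),
    P = <[x *m basis i]>%VS :> {vspace 'rV[F]_4}.
Proof.
move=> x0; have Px : (\dim <[x *m basis i]> == 1)%N &&
    (<[x *m basis i]> <= L_line ht i)%VS.
  by rewrite dim_vline basis_neq0 // -memvE basis_mem.
by exists (PointOn Px).
Qed.

(** * Morphisms realize permutations *)

(** Stated for arbitrary lines, with the indices bound by equations, so that it fits induction on
    [groupoid_hom]. It is vacuous off the configuration, hence the membership hypothesis in
    [realizes_comp]. *)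
Definition realizes (L L'' : line F) (s : {perm 'I_4})
    (f : point_on L -> point_on L'') : Prop :=
  forall (i k : 'I_10) (x : 'rV_2) (P : point_on L),
    L = L_line ht i -> L'' = L_line ht k -> x != 0 ->
    P = <[x *m basis i]>%VS :> {vspace 'rV[F]_4} ->
    f P = <[x *m rho s *m basis k]>%VS :> {vspace 'rV[F]_4}.

Lemma realizes_comp (L1 L2 L3 : line F) (f : point_on L1 -> point_on L2)
    (g : point_on L2 -> point_on L3) s s' :
  L2 \in config ht -> realizes s f -> realizes s' g ->
  realizes (s' * s)%g (g \o f).
Proof.
move=> /codomP[j L2j] fs gs i k x P Li Lk x0 Px.
have Pf := fs i j x P Li L2j x0 Px.
rewrite /= (gs j k _ _ L2j Lk (rho_neq0 s x0) Pf).
apply/mxsim_vline/mxsimM; last exact: mxsim_refl.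
by rewrite -mulmxA; apply: mxsimM (mxsim_refl x) (rhoM _ _).
Qed.

Lemma realizes_eq (i k : 'I_10)
    (f g : point_on (L_line ht i) -> point_on (L_line ht k)) s :
  realizes s f -> realizes s g -> f = g.
Proof.
move=> fs gs; apply: functional_extensionality => P; apply: val_inj => /=.
by have [x x0 Px] := point_coord P; rewrite (fs i k x) // (gs i k x).
Qed.

Lemma realizes_inj (i k : 'I_10)
    (f : point_on (L_line ht i) -> point_on (L_line ht k)) s s' :
  realizes s f -> realizes s' f -> s = s'.
Proof.
move=> fs fs'; apply: rho_inj => x x0; have [P Px] := coord_point i x0.
have := fs i k x P erefl erefl x0 Px; rewrite (fs' i k x) //.
move/esym/vline_mxsim => -[|a a0]; first by rewrite basis_neq0 ?rho_neq0.
by rewrite scalemxAl => /basis_inj eq; exists a.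
Qed.

Lemma realizes1 (i : 'I_10) : @realizes (L_line ht i) (L_line ht i) 1%g id.
Proof.
move=> _ _ x P /L_line_inj <- /L_line_inj <- x0 ->.
apply/esym/mxsim_vline/mxsimM; last exact: mxsim_refl.
by rewrite -[X in mxsim _ X]mulmx1; apply: mxsimM (mxsim_refl x) rho1.
Qed.

(** The vector x E_i - a y is killed by D_j, so it lies in L_j; hence y lies both on L_k and in the
    plane spanned by P and L_j. *)
Lemma proj_realizes (i j k : 'I_10)
    (hij : disjoint_lines (L_line ht i) (L_line ht j))
    (hjk : disjoint_lines (L_line ht j) (L_line ht k)) s :
  mxsim (basis i *m forms j) (rho s *m basis k *m forms j) ->
  realizes s (proj hij hjk).
Proof.
case=> a a0 E _ _ x P /L_line_inj <- /L_line_inj <- x0 Px.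
set y := x *m rho s *m basis k.
have y0 : y != 0 by rewrite basis_neq0 ?rho_neq0.
apply/esym/eqP; rewrite eqEdim dim_vline y0.
have /andP[/eqP -> _] := point_onP (proj hij hjk P); rewrite andbT -memvE.
rewrite memv_cap basis_mem andbT Px.
have z : x *m basis i - a *: y \in L_sp t j.
  by rewrite mem_L_sp mulmxBl -scalemxAl -!mulmxA E -!scalemxAr -!mulmxA subrr.
rewrite -[y](scalerK a0) -[a *: y](subKr (x *m basis i)) memvZ //.
by rewrite memv_add ?memv_line // memvN.
Qed.

(** * Every permutation is realized by a loop *)

Definition realized (i k : 'I_10) (s : {perm 'I_4}) : Prop :=
  exists2 f : point_on (L_line ht i) -> point_on (L_line ht k),
    groupoid_hom (config ht) f & realizes s f.

Lemma config_line (i : 'I_10) : L_line ht i \in config ht.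
Proof. exact: codom_f. Qed.

Lemma realized_comp i j k s s' :
  realized i j s -> realized j k s' -> realized i k (s' * s)%g.
Proof.
case=> f hf fs [g hg gs]; exists (g \o f); first exact: hom_comp.
by apply: realizes_comp => //; exact: config_line.
Qed.

Lemma realized_proj (i j k : 'I_10) s : i != j -> j != k -> i != k ->
  mxsim (basis i *m forms j) (rho s *m basis k *m forms j) -> realized i k s.
Proof.
move=> ij jk ik E.
exists (proj (L_line_disjoint ht ij) (L_line_disjoint ht jk)).
  by apply: hom_proj; rewrite ?config_line // (inj_eq (@L_line_inj _ _ ht)).
exact: proj_realizes.
Qed.

Lemma proj_perm (i j k : 'I_10) : i != j -> j != k ->
  exists s, mxsim (basis i *m forms j) (rho s *m basis k *m forms j).
Proof.
move=> /basis_forms[s Es]; rewrite eq_sym => /basis_forms[s' Es'].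
(* Since [rho] reverses products, multiplying by [rho s'] on the right cancels the factor s'^-1. *)
exists (s'^-1 * s)%g; apply: mxsim_trans Es _; apply: mxsim_sym.
rewrite -mulmxA; apply: mxsim_trans (mxsimM (mxsim_refl _) Es') _.
by apply: mxsim_trans (rhoM _ _) _; rewrite mulKVg; exact: mxsim_refl.
Qed.

Lemma realized_code (i j k : 'I_10) c :
    i != j -> j != k -> i != k -> c \in codes ->
    eprop (emulmx 2 4 2 (nth [::] line_basis i) (nth [::] line_forms j))
      (emulmx 2 2 2 (rotation c)
        (emulmx 2 4 2 (nth [::] line_basis k) (nth [::] line_forms j))) ->
  exists2 s, code s = c & realized i k s.
Proof.
move=> ij jk ik /code_onto[s <-] /eprop_mxsim; rewrite !evmxM mulmxA => E.
by exists s => //; exact: realized_proj E.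
Qed.

Let o (n : nat) : 'I_10 := inord n.

Lemma realized_loops0 s : realized (o 0) (o 0) s.
Proof.
suff : exists2 s', code s' = code s & realized (o 0) (o 0) s'.
  by case=> s' /code_inj ->.
have ov n : (n < 10)%N -> o n = n :> nat by move=> ?; rewrite inordK.
have on m n : (m < 10)%N -> (n < 10)%N -> m != n -> o m != o n.
  by move=> m10 n10; apply: contra_neq => /(congr1 val); rewrite /= !ov.
have step i j k c : (i < 10)%N -> (j < 10)%N -> (k < 10)%N ->
    i != j -> j != k -> i != k -> c \in codes ->
    eprop (emulmx 2 4 2 (nth [::] line_basis i) (nth [::] line_forms j))
      (emulmx 2 2 2 (rotation c)
        (emulmx 2 4 2 (nth [::] line_basis k) (nth [::] line_forms j))) ->
  exists2 s, code s = c & realized (o i) (o k) s.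
  move=> i10 j10 k10 ij jk ik cC E.
  by apply: (@realized_code _ (o j)) => //; rewrite ?on ?ov.
(* The outward leg L_0 -> L_2 through L_1 is shared by both loops. Returning through L_4 contributes
   the identity, through L_6 a 3-cycle. *)
have [s1 c1 r1] : exists2 s, code s = [:: 3; 2; 0; 1] & realized (o 0) (o 2) s.
  by apply: (@step _ 1) => //; vm_compute.
apply: (@codes_generated (fun c => exists2 s', code s' = c & _ s')).
- move=> _ _ [u <- ru] [v <- rv]; exists (u * v)%g; first exact: codeM.
  exact: realized_comp rv ru.
- have [s2 c2 r2] : exists2 s, code s = [:: 0; 1; 2; 3] & realized (o 2) (o 0) s.
    by apply: (@step _ 4) => //; vm_compute.
  exists (s2 * s1)%g; last exact: realized_comp r1 r2.
  by rewrite codeM c1 c2.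
- have [s2 c2 r2] : exists2 s, code s = [:: 1; 2; 0; 3] & realized (o 2) (o 0) s.
    by apply: (@step _ 6) => //; vm_compute.
  exists (s2 * s1)%g; last exact: realized_comp r1 r2.
  by rewrite codeM c1 c2.
exact: code_in_codes.
Qed.

Lemma realized_some i k : i != k -> exists s, realized i k s.
Proof.
move=> ik; have [j] : exists j, j \notin [:: i; k].
  have /subsetPn[j _ jn] : ~~ ([set: 'I_10] \subset [set i; k]).
    apply/negP => /subset_leq_card.
    by rewrite cardsT card_ord cards2; case: (_ != _).
  by exists j; move: jn; rewrite !inE.
rewrite !inE negb_or => /andP[ji jk].
have [|s E] := @proj_perm i j k _ jk; first by rewrite eq_sym.
by exists s; apply: realized_proj E => //; rewrite eq_sym.
Qed.

(** Go from L_i to L_0 (realizing m), around a loop there, and back (realizing m'); the loop at L_0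
    is chosen to cancel m and m'. *)
Lemma realized_loops i s : realized i i s.
Proof.
have [-> | i0] := eqVneq i (o 0); first exact: realized_loops0.
have [m rm] := realized_some i0.
have [m' rm'] : exists m', realized (o 0) i m'.
  by apply: realized_some; rewrite eq_sym.
have r0 := realized_loops0 (m'^-1 * s * m^-1)%g.
have := realized_comp (realized_comp rm r0) rm'.
by rewrite -!mulgA mulVg mulg1 mulKVg.
Qed.

(** * The isomorphism with S_4 *)

Lemma hom_realizes (L L'' : line F) (f : point_on L -> point_on L'') :
  groupoid_hom (config ht) f ->
  [/\ L \in config ht, L'' \in config ht & exists s, realizes s f].
Proof.
elim=> {L L'' f} [L L' L'' hLL' hL'L'' Lc L'c L''c LL' L'L'' _|].
  split=> //; move: Lc L'c L''c => /codomP[i Li] /codomP[j Lj] /codomP[k Lk].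
  subst L L' L''; rewrite !(inj_eq (@L_line_inj _ _ ht)) in LL' L'L''.
  by have [s E] := proj_perm LL' L'L''; exists s; exact: proj_realizes.
move=> L1 L2 L3 f g _ [? L2c [s fs]] _ [_ ? [s' gs]]; split=> //.
by exists (s' * s)%g; exact: realizes_comp.
Qed.

Lemma config_Aut (L : line F) : L \in config ht ->
  is_group_isomorphic_to {perm 'I_4} (groupoid_Aut (config ht) L).
Proof.
case/codomP => i ->.
have /fin_all_exists[phi phiP] : forall s, exists f,
    groupoid_hom (config ht) f /\ @realizes (L_line ht i) (L_line ht i) s f.
  by move=> s; have [f] := realized_loops i s; exists f.
have hom s := proj1 (phiP s); have real s := proj2 (phiP s).
exists phi; split.
- move=> s s' eq; apply: (realizes_inj (real s)); rewrite eq; exact: real.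
- exact: realizes_eq (real 1%g) (@realizes1 i).
- move=> s s'; apply: (realizes_eq (real (s * s')%g)).
  by apply: realizes_comp => //; exact: config_line.
move=> f; split=> [hf | [s ->]]; last exact: hom.
have [_ _ [s fs]] := hom_realizes hf.
by exists s; exact: realizes_eq fs (real s).
Qed.

End Configuration.

Theorem theorem3 (R : realType) (t : R[i]) (ht : t ^+ 2 + t + 1 = 0) :
  forall L : line R[i], L \in config ht ->
    is_group_isomorphic_to {perm 'I_4} (groupoid_Aut (config ht) L).
Proof. exact: config_Aut. Qed.
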